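(* Let $\mathrm{D}$ be a principal ideal domain and let $A\in\mathrm{D}^{m\times n}$ be a matrix of McCoy's rank $r$. Then there exists a unique $m\times n$ $r$-sub-permutation matrix $\mathcal{R}_A$ such that every leading sub-matrix of $\mathcal{R}_A$ has the same (McCoy) rank as the corresponding leading sub-matrix of $A$.
   Context: For a matrix $A$ over a commutative ring $R$ with unity, $I_t(A)$ denotes the ideal of $R$ generated by all $t\times t$ minors of $A$, with $I_0(A)=R$ (and $I_t(A)=(0)$ for $t>\min(m,n)$). For $S\subseteq R$, $\mathrm{Ann}(S)=\{x\in R: xy=0\ \forall y\in S\}$. McCoy's rank of $A$ is $\max\{t:\mathrm{Ann}(I_t(A))=(0)\}$. An $r$-sub-permutation matrix is a matrix of rank $r$ with only $r$ nonzero entries, all equal to one (hence at most one nonzero entry per row and per column). A leading sub-matrix of an $m\times n$ matrix is the sub-matrix formed by its first $i$ rows and first $j$ columns, for some $1\le i\le m$, $1\le j\le n$. *)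

(* Defs.v *)
From HB Require Import structures.
From mathcomp Require Import all_boot all_order all_algebra.
From mathcomp Require Import boolp classical_sets.

Set Implicit Arguments.
Unset Strict Implicit.
Unset Printing Implicit Defensive.

Import GRing.Theory.
Local Open Scope classical_set_scope.
Local Open Scope ring_scope.

Definition is_ideal (R : comNzRingType) (I : set R) : Prop :=
  I 0 /\ (forall a x y : R, I x -> I y -> I (a * x + y)).

Definition ideal_gen (R : comNzRingType) (S : set R) : set R :=
  smallest (@is_ideal R) S.

Definition is_PID (D : idomainType) : Prop :=
  forall I : set D, is_ideal I -> exists x : D, I = ideal_gen [set x].

Definition Ann (R : comNzRingType) (S : set R) : set R :=
  [set x | forall y, S y -> x * y = 0].

Definition ord_increasing (p q : nat) (f : 'I_p -> 'I_q) : Prop :=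
  forall i j : 'I_p, (i < j)%N -> (f i < f j)%N.

Definition minors (R : comNzRingType) (m n : nat) (A : 'M[R]_(m, n)) (t : nat) :
    set R :=
  [set x | exists (f : 'I_t -> 'I_m) (g : 'I_t -> 'I_n),
     [/\ ord_increasing f, ord_increasing g & x = \det (mxsub f g A)]].

(* For t = 0 the only minor is the empty determinant 1, so that the ideal is R;
   for t > min(m, n) there is no minor and the ideal is (0). *)
Definition minor_ideal (R : comNzRingType) (m n : nat) (A : 'M[R]_(m, n))
    (t : nat) : set R :=
  ideal_gen (minors A t).

(* The maximum may be taken over t <= min(m, n), since beyond that bound
   Ann (minor_ideal A t) = R <> (0); see mccoy_rank_max. *)
Definition mccoy_rank (R : comNzRingType) (m n : nat) (A : 'M[R]_(m, n)) : nat :=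
  \max_(t < (minn m n).+1 | `[< Ann (minor_ideal A t) = [set 0] >]) t.

Definition is_subperm_mx (R : comNzRingType) (m n r : nat) (P : 'M[R]_(m, n)) :
    Prop :=
  [/\ mccoy_rank P = r,
      #|[pred ij : 'I_m * 'I_n | P ij.1 ij.2 != 0]| = r
    & forall i j, P i j != 0 -> P i j = 1].

Definition leading_submx (R : comNzRingType) (m n i j : nat)
    (le_im : (i <= m)%N) (le_jn : (j <= n)%N) (A : 'M[R]_(m, n)) : 'M[R]_(i, j) :=
  mxsub (widen_ord le_im) (widen_ord le_jn) A.

Lemma is_ideal0 (R : comNzRingType) : is_ideal [set (0 : R)].
Proof. by split=> // a x y /= -> ->; rewrite mulr0 addr0. Qed.

Lemma ord_increasing_leq (p q : nat) (f : 'I_p -> 'I_q) :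
  ord_increasing f -> (p <= q)%N.
Proof.
move=> hf; have fI : injective f.
  move=> i j eq_f; apply: val_inj => /=.
  by case: (ltngtP i j) => // /hf; rewrite eq_f ltnn.
by have := leq_card f fI; rewrite !card_ord.
Qed.

Lemma minor_ideal0 (R : comNzRingType) (m n : nat) (A : 'M[R]_(m, n)) :
  minor_ideal A 0 = setT.
Proof.
apply/seteqP; split=> // x _ I [[I0 Icl] subI].
have I1 : I 1.
  apply: subI; exists (fun i : 'I_0 => False_rect _ (notF (ltn_ord i))).
  exists (fun i : 'I_0 => False_rect _ (notF (ltn_ord i))).
  by split; [case | case | rewrite det_mx00].
by have := Icl x 1 0 I1 I0; rewrite mulr1 addr0.
Qed.

Lemma minor_ideal_gt (R : comNzRingType) (m n : nat) (A : 'M[R]_(m, n))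
    (t : nat) :
  (minn m n < t)%N -> minor_ideal A t = [set 0].
Proof.
move=> lt_t; apply/seteqP; split=> [x|x ->]; last by move=> I [[]].
apply: smallest_sub; first exact: is_ideal0.
move=> y [f [g [/ord_increasing_leq tm /ord_increasing_leq tn _]]].
by move: lt_t; rewrite ltnNge leq_min tm tn.
Qed.

Lemma mccoy_rank_max (R : comNzRingType) (m n : nat) (A : 'M[R]_(m, n)) :
  Ann (minor_ideal A (mccoy_rank A)) = [set 0] /\
  (forall t, Ann (minor_ideal A t) = [set 0] -> (t <= mccoy_rank A)%N).
Proof.
have P0 : Ann (minor_ideal A 0) = [set 0].
  rewrite minor_ideal0; apply/seteqP; split=> [x /(_ 1 I)|x -> y _].
    by rewrite mulr1.
  by rewrite mul0r.
split=> [|t Pt]; last first.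
  have [le_t|lt_t] := leqP t (minn m n); last first.
    have /seteqP[/(_ 1) contra _] := Pt.
    have /eqP : (1 : R) = 0.
      by apply: contra => y; rewrite minor_ideal_gt // => ->; rewrite mulr0.
    by rewrite oner_eq0.
  rewrite /mccoy_rank.
  by apply: (bigmax_sup (Ordinal (le_t : (t < (minn m n).+1)%N))) => //=; apply/asboolP.
rewrite /mccoy_rank.
elim/big_ind: _ => // [x y Px Py|i /asboolP//].
by rewrite /maxn; case: ifP.
Qed.

(* Main.v *)
Require Import Defs.
From mathcomp Require Import all_boot all_order all_algebra.
From mathcomp Require Import boolp classical_sets.
From mathcomp Require Import zify.

(* Over a domain, the McCoy rank is the rank over the fraction field, so take
   B over a field and let rho i j be the rank of its i x j leading part.  The
   Frobenius inequality makes the mixed second difference of rho nonnegative;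
   since rho grows by at most 1 per step, this difference is a 0/1 matrix with
   at most one 1 in each row and column.  It is the required matrix, since
   summing it over the leading part gives back rho.  Conversely, if the rank of
   M equals its number of nonzero entries, then so does the rank of each leading
   part, by subadditivity of the rank; hence the leading ranks determine the
   support of M. *)

Import GRing.Theory.
Local Open Scope ring_scope.

(** * McCoy rank over a domain as rank over the fraction field *)

Lemma Ann_minor_idealP (D : idomainType) (m n : nat) (A : 'M[D]_(m, n)) t :
  Ann (minor_ideal A t) = [set 0]%classic <->
  exists2 x, minors A t x & x != 0.
Proof.
split=> [annA | [x minx x0]]; last first.
  apply/seteqP; split=> [y /(_ x (sub_gen_smallest minx)) /eqP | y -> z _].
    by rewrite mulf_eq0 (negPf x0) orbF => /eqP.
  by rewrite mul0r.
have [// | no_minor] := pselect (exists2 x, minors A t x & x != 0).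
have sub0 : (minor_ideal A t `<=` [set 0])%classic.
  apply: smallest_sub; first exact: is_ideal0.
  move=> x minx /=; apply/eqP/negPn/negP => x0.
  by apply: no_minor; exists x.
have ann1 : Ann (minor_ideal A t) 1 by move=> y /sub0 ->; rewrite mulr0.
by move: ann1; rewrite annA => /= /eqP; rewrite oner_eq0.
Qed.

(** [minors] admits only increasing index maps, while [maxrankfun] is merely injective; listing the
    image of [f] in increasing order bridges the two. *)
Lemma ord_increasing_codom {m t : nat} {f : 'I_t -> 'I_m} : injective f ->
  exists2 h : 'I_t -> 'I_m, ord_increasing h & forall i, exists j, f i = h j.
Proof.
move=> fI; pose s := enum (codom f).
have sz_s : size s = t by rewrite -cardE card_codom // card_ord.
have sorted_s : sorted (fun i j : 'I_m => i < j)%N s.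
  rewrite /s /enum_mem -enumT.
  apply: sorted_filter; first by move=> ? ? ?; apply: ltn_trans.
  by have := iota_ltn_sorted 0 m; rewrite -val_enum_ord sorted_map.
have mem_s i : f i \in s by rewrite mem_enum codom_f.
(* The default [f j] is never reached, as [size s = t]; it only supplies some element of ['I_m]. *)
exists (fun j => nth (f j) s j) => [i j lt_ij | i].
  rewrite (set_nth_default (f i)) ?sz_s //.
  have tr : transitive (fun i j : 'I_m => i < j)%N.
    by move=> ? ? ?; apply: ltn_trans.
  by apply: (sorted_ltn_nth tr (f i) sorted_s); rewrite ?inE ?sz_s.
have lt_it : (index (f i) s < t)%N by rewrite -[X in (_ < X)%N]sz_s index_mem.
by exists (Ordinal lt_it); rewrite /= nth_index.
Qed.

Lemma increasing_rowsub_rank {F : fieldType} {m n r : nat} {B : 'M[F]_(m, n)} :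
  \rank B = r ->
  exists2 h : 'I_r -> 'I_m, ord_increasing h & \rank (rowsub h B) = r.
Proof.
move=> <-; have [h h_incr h_codom] := ord_increasing_codom (@maxrankfun_inj _ _ _ B).
exists h => //; apply/eqP; rewrite eqn_leq rank_leq_row.
rewrite -{1}(eq_maxrowsub B); apply: mxrankS; apply/row_subP => i.
have [j e] := h_codom i; rewrite row_rowsub e -row_rowsub.
exact: row_sub.
Qed.

Lemma mxrank_mxsub (F : fieldType) (m n p q : nat) (f : 'I_p -> 'I_m)
    (g : 'I_q -> 'I_n) (B : 'M[F]_(m, n)) :
  (\rank (mxsub f g B) <= \rank B)%N.
Proof.
have rowsub_le p' m' n' (h : 'I_p' -> 'I_m') (C : 'M[F]_(m', n')) :
    (\rank (rowsub h C) <= \rank C)%N.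
  by apply: mxrankS; apply/row_subP => i; rewrite row_rowsub row_sub.
have -> : mxsub f g B = rowsub f (rowsub g B^T)^T.
  by apply/matrixP=> i j; rewrite !mxE.
by rewrite (leq_trans (rowsub_le _ _ _ _ _)) // mxrank_tr -[leqRHS]mxrank_tr.
Qed.

(** A nonzero minor becomes an invertible submatrix over the fraction field, which bounds the McCoy
    rank by [\rank]; conversely, selecting independent rows and then independent columns yields a
    nonzero minor of size [\rank]. *)
Lemma mccoy_rank_tofrac (D : idomainType) (m n : nat) (A : 'M[D]_(m, n)) :
  mccoy_rank A = \rank (map_mx (@tofrac D) A).
Proof.
set B := map_mx _ A; have [annA max_rank] := mccoy_rank_max A.
apply/eqP; rewrite eqn_leq; apply/andP; split.
  have /Ann_minor_idealP[x [f [g [_ _ ->]]] det0] := annA.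
  have := mxrank_mxsub _ _ _ _ _ f g B; rewrite -map_mxsub mxrank_unit //.
  by rewrite unitmxE unitfE det_map_mx tofrac_eq0.
apply/max_rank/Ann_minor_idealP.
have [f f_incr rk_f] := increasing_rowsub_rank (erefl (\rank B)).
(* Transposing turns the second row selection into a selection of columns. *)
rewrite -mxrank_tr in rk_f; have [g g_incr rk_g] := increasing_rowsub_rank rk_f.
exists (\det (mxsub f g A)); first by exists f, g.
have -> : mxsub f g A = (rowsub g (rowsub f A)^T)^T.
  by apply/matrixP=> i j; rewrite !mxE.
rewrite det_tr -tofrac_eq0 -det_map_mx map_mxsub -map_trmx map_mxsub.
by rewrite -unitfE -unitmxE -row_free_unit /row_free rk_g.
Qed.

(** * Leading parts and their ranks *)

(* The leading i x j part padded with zeros, so that all leading parts share one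
   type. *)
Definition trunc_mx {R : comNzRingType} {m n : nat} (i j : nat) (B : 'M[R]_(m, n)) :
    'M[R]_(m, n) :=
  \matrix_(a, b) if (a < i)%N && (b < j)%N then B a b else 0.

Lemma tr_trunc_mx (R : comNzRingType) (m n i j : nat) (B : 'M[R]_(m, n)) :
  (trunc_mx i j B)^T = trunc_mx j i B^T.
Proof. by apply/matrixP => a b; rewrite !mxE andbC. Qed.

Lemma pid_mulmxE {R : comNzRingType} {m n : nat} (i : nat) (B : 'M[R]_(m, n)) a b :
  (pid_mx i *m B) a b = if (a < i)%N then B a b else 0.
Proof.
rewrite mxE (bigD1 a) //= big1 ?addr0 => [|k ka]; last first.
  by rewrite mxE val_eqE eq_sym (negPf ka) mul0r.
by rewrite mxE eqxx /=; case: ifP; rewrite ?mul1r ?mul0r.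
Qed.

Lemma mulmx_pidE {R : comNzRingType} {m n : nat} (j : nat) (B : 'M[R]_(m, n)) a b :
  (B *m pid_mx j) a b = if (b < j)%N then B a b else 0.
Proof.
rewrite -[B *m _]trmxK trmx_mul tr_pid_mx mxE pid_mulmxE.
by rewrite [B^T _ _]mxE.
Qed.

Lemma trunc_mxE (R : comNzRingType) (m n i j : nat) (B : 'M[R]_(m, n)) :
  trunc_mx i j B = pid_mx i *m B *m pid_mx j.
Proof.
apply/matrixP => a b; rewrite mulmx_pidE pid_mulmxE mxE andbC.
by case: (b < j)%N.
Qed.

(** Unlike in [trunc_mxE], the two [pid_mx] are rectangular, of sizes i x m and n x j, so they cut
    the matrix down instead of padding it. *)
Lemma leading_submxE (R : comNzRingType) (m n i j : nat) (le_im : (i <= m)%N)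
    (le_jn : (j <= n)%N) (B : 'M[R]_(m, n)) :
  leading_submx le_im le_jn B = pid_mx i *m B *m pid_mx j.
Proof.
apply/matrixP => a b; rewrite !mxE (bigD1 (widen_ord le_jn b)) //=.
rewrite big1 ?addr0 => [|k kb]; last first.
  by rewrite [X in _ * X]mxE -[_ == _ :> nat]/(k == widen_ord le_jn b) (negPf kb) mulr0.
rewrite [X in _ * X]mxE eqxx /= ltn_ord mulr1 mxE (bigD1 (widen_ord le_im a)) //=.
rewrite big1 ?addr0 => [|k ka]; last first.
  by rewrite mxE eq_sym -[_ == _ :> nat]/(k == widen_ord le_im a) (negPf ka) mul0r.
by rewrite mxE eqxx /= ltn_ord mul1r.
Qed.

Lemma mxrank_leading_submx (F : fieldType) (m n i j : nat) (le_im : (i <= m)%N)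
    (le_jn : (j <= n)%N) (B : 'M[F]_(m, n)) :
  \rank (leading_submx le_im le_jn B) = \rank (trunc_mx i j B).
Proof.
apply/eqP; rewrite eqn_leq; apply/andP; split.
  suff -> : leading_submx le_im le_jn B = leading_submx le_im le_jn (trunc_mx i j B).
    exact: mxrank_mxsub.
  by apply/matrixP => a b; rewrite !mxE /= !ltn_ord.
have -> : trunc_mx i j B = pid_mx i *m leading_submx le_im le_jn B *m pid_mx j.
  by rewrite leading_submxE !mulmxA pid_mx_id // -!mulmxA pid_mx_id // !mulmxA trunc_mxE.
exact: leq_trans (mxrankM_maxl _ _) (mxrankM_maxr _ _).
Qed.

(** Frobenius inequality for the product of [pid_mx i], the larger truncation and [pid_mx j]: every
    partial product is again a truncation. *)
Lemma trunc_rank_supermod {F : fieldType} {m n : nat} (B : 'M[F]_(m, n))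
    (i j i' j' : nat) : (i <= i' -> j <= j' ->
  \rank (trunc_mx i' j B) + \rank (trunc_mx i j' B) <=
  \rank (trunc_mx i' j' B) + \rank (trunc_mx i j B))%N.
Proof.
move=> le_i le_j.
have e1 : pid_mx i *m trunc_mx i' j' B = trunc_mx i j' B.
  apply/matrixP => a b; rewrite pid_mulmxE !mxE.
  by case: (ltnP a i) => // /leq_trans ->.
have e2 : trunc_mx i' j' B *m pid_mx j = trunc_mx i' j B.
  apply/matrixP => a b; rewrite mulmx_pidE !mxE.
  by case: (ltnP b j) => [/leq_trans -> //|]; rewrite ?andbF.
have e3 : trunc_mx i j' B *m pid_mx j = trunc_mx i j B.
  apply/matrixP => a b; rewrite mulmx_pidE !mxE.
  by case: (ltnP b j) => [/leq_trans -> //|]; rewrite ?andbF.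
have := mxrank_Frobenius (pid_mx i : 'M_m) (trunc_mx i' j' B) (pid_mx j : 'M_n).
by rewrite e1 e2 e3 addnC.
Qed.

Lemma trunc_rankSl {F : fieldType} {m n : nat} (B : 'M[F]_(m, n)) (i j : nat) :
  (\rank (trunc_mx i.+1 j B) <= (\rank (trunc_mx i j B)).+1)%N.
Proof.
have [le_mi | lt_im] := leqP m i.
  rewrite (_ : trunc_mx i.+1 j B = trunc_mx i j B) //.
  apply/matrixP => a b; rewrite !mxE.
  by rewrite !(leq_trans (ltn_ord a)) // leqW.
(* The new row [i], written as a column times a row so that its rank is visibly at most 1. *)
pose C := (\col_a ((a : 'I_m) == Ordinal lt_im)%:R) *m
  row (Ordinal lt_im) (trunc_mx i.+1 j B).
have -> : trunc_mx i.+1 j B = trunc_mx i j B + C.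
  apply/matrixP => a b; rewrite !mxE big_ord1 !mxE ltnS /= leqnn /= -val_eqE /=.
  case: (ltngtP a i) => [_|_|ia] /=; rewrite ?mul0r ?addr0 ?mul1r ?add0r //=.
  by rewrite (_ : a = Ordinal lt_im) //; apply: val_inj.
rewrite (leq_trans (mxrank_add _ _)) // -addn1 leq_add2l.
exact: leq_trans (mxrankM_maxr _ _) (rank_leq_row _).
Qed.

Lemma trunc_rankSr {F : fieldType} {m n : nat} (B : 'M[F]_(m, n)) (i j : nat) :
  (\rank (trunc_mx i j.+1 B) <= (\rank (trunc_mx i j B)).+1)%N.
Proof. by rewrite -mxrank_tr -[X in (_ <= X.+1)%N]mxrank_tr !tr_trunc_mx trunc_rankSl. Qed.

(** * Rank against the number of nonzero entries *)

Definition nnz {R : comNzRingType} {m n : nat} (M : 'M[R]_(m, n)) : nat :=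
  #|[pred ij : 'I_m * 'I_n | M ij.1 ij.2 != 0]|.

Lemma nnzE (R : comNzRingType) (m n : nat) (M : 'M[R]_(m, n)) :
  nnz M = (\sum_i \sum_j (M i j != 0)%R)%N.
Proof. by rewrite pair_bigA /nnz -sum1_card big_mkcond. Qed.

Lemma mxrank_sum {F : fieldType} {m n : nat} (I : finType) (f : I -> 'M[F]_(m, n)) :
  (\rank (\sum_i f i)%R <= \sum_i \rank (f i))%N.
Proof.
elim/big_rec2: _ => [|i k M _ le_Mk]; first by rewrite mxrank0.
by rewrite (leq_trans (mxrank_add _ _)) // leq_add2l.
Qed.

Lemma mxrank_le_nnz (F : fieldType) (m n : nat) (M : 'M[F]_(m, n)) :
  (\rank M <= nnz M)%N.
Proof.
rewrite {1}[M]matrix_sum_delta nnzE (leq_trans (mxrank_sum _ _)) //.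
apply: leq_sum => i _; rewrite (leq_trans (mxrank_sum _ _)) //.
apply: leq_sum => j _; have [-> | M0] := eqVneq; first by rewrite scale0r mxrank0.
by rewrite (leq_trans (mxrank_scale _ _)) // mxrank_delta.
Qed.

(** Split [M] into its truncation and the remainder: [nnz] is additive, the rank is subadditive and
    at most [nnz] on each piece, so equality for [M] forces equality on the truncation. *)
Lemma nnz_trunc_rank (F : fieldType) (m n i j : nat) (M : 'M[F]_(m, n)) :
  \rank M = nnz M -> \rank (trunc_mx i j M) = nnz (trunc_mx i j M).
Proof.
move=> rkM; apply/eqP; rewrite eqn_leq mxrank_le_nnz /=.
rewrite -(leq_add2r (nnz (M - trunc_mx i j M))).
have -> : (nnz (trunc_mx i j M) + nnz (M - trunc_mx i j M) = nnz M)%N.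
  rewrite !nnzE -big_split; apply: eq_bigr => a _.
  rewrite -big_split; apply: eq_bigr => b _; rewrite !mxE /=.
  by case: ifP; rewrite ?subr0 ?subrr ?eqxx ?addn0.
rewrite -rkM -{1}[M](subrK (trunc_mx i j M)) addrC.
by rewrite (leq_trans (mxrank_add _ _)) // leq_add2l mxrank_le_nnz.
Qed.

(** Counting over leading parts is a double summation, so its mixed second difference returns the
    indicator of the support. *)
Lemma nnz_truncSS {R : comNzRingType} {m n : nat} (M : 'M[R]_(m, n))
    (i : 'I_m) (j : 'I_n) :
  (nnz (trunc_mx i.+1 j.+1 M) + nnz (trunc_mx i j M) =
   nnz (trunc_mx i j.+1 M) + nnz (trunc_mx i.+1 j M) + (M i j != 0)%R)%N.
Proof.
have -> : (M i j != 0 : nat) = (\sum_a \sum_b ((a == i) && (b == j) && (M a b != 0)%R))%N.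
  rewrite (bigD1 i) //= [X in (_ + X)%N]big1 => [|a /negPf ai].
    by rewrite addn0 (bigD1 j) //= !eqxx big1 ?addn0 // => b /negPf ->.
  by apply: big1 => b _; rewrite ai.
rewrite !nnzE -!big_split; apply: eq_bigr => a _.
rewrite -!big_split; apply: eq_bigr => b _; rewrite !mxE -!val_eqE /=.
by rewrite !ltnS; case: ltngtP => _; case: ltngtP => _ /=;
  rewrite ?eqxx ?addn0 ?add0n ?addnn.
Qed.

(** Boundary values and mixed second differences determine a function on the grid. Negative terms
    are moved across the equality because subtraction on [nat] truncates. *)
Lemma mixed_diff_inj {m n : nat} {c d : nat -> nat -> nat} :
  (forall i, c i 0 = d i 0)%N -> (forall j, c 0 j = d 0 j)%N ->
  (forall i j, (i < m)%N -> (j < n)%N ->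
     (c i.+1 j.+1 + c i j + (d i j.+1 + d i.+1 j) =
      d i.+1 j.+1 + d i j + (c i j.+1 + c i.+1 j))%N) ->
  forall i j, (i <= m)%N -> (j <= n)%N -> c i j = d i j.
Proof.
move=> c0 d0 cd; elim=> [|i IHi] // ; elim=> [|j IHj] // lt_im lt_jn.
have := cd i j lt_im lt_jn.
by rewrite IHj ?(ltnW lt_jn) // !IHi ?(ltnW lt_im) ?(ltnW lt_jn) //; lia.
Qed.

Lemma partial_perm_mx_rank (F : fieldType) (m n : nat) (M : 'M[F]_(m, n)) :
  (forall i j, M i j != 0 -> M i j = 1) ->
  (forall i j k, M i j != 0 -> M i k != 0 -> j = k) ->
  (forall i j k, M i k != 0 -> M j k != 0 -> i = j) ->
  \rank M = nnz M.
Proof.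
move=> M01 rowM colM; apply/eqP; rewrite eqn_leq mxrank_le_nnz /=.
pose e (k : 'I_(nnz M)) : 'I_m * 'I_n := enum_val k.
have eM k : M (e k).1 (e k).2 != 0 by have := enum_valP k.
(* Taking the row and the column of each nonzero position gives an identity matrix: a nonzero entry
   at [(k, l)] shares its row with position [k] and its column with position [l], whence [k = l]. *)
have <- : \rank (mxsub (fun k => (e k).1) (fun k => (e k).2) M) = nnz M.
  rewrite (_ : mxsub _ _ M = 1%:M) ?mxrank1 //; apply/matrixP => k l; rewrite !mxE.
  have [<- | kl] := eqVneq; first exact: M01.
  apply/eqP/negPn/negP => Mkl; case/eqP: kl; apply: enum_val_inj.
  rewrite -/(e k) -/(e l); have := rowM _ _ _ (eM k) Mkl.
  have := colM _ _ _ Mkl (eM l).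
  by case: (e k) (e l) => [? ?] [? ?] /= -> ->.
exact: mxrank_mxsub.
Qed.

Lemma trunc_mx_id {R : comNzRingType} {m n : nat} (M : 'M[R]_(m, n)) :
  trunc_mx m n M = M.
Proof. by apply/matrixP => a b; rewrite mxE !ltn_ord. Qed.

Lemma trunc_mx0l {R : comNzRingType} {m n : nat} (j : nat) (M : 'M[R]_(m, n)) :
  trunc_mx 0 j M = 0.
Proof. by apply/matrixP => a b; rewrite !mxE. Qed.

Lemma trunc_mx0r {R : comNzRingType} {m n : nat} (i : nat) (M : 'M[R]_(m, n)) :
  trunc_mx i 0 M = 0.
Proof. by apply/matrixP => a b; rewrite !mxE andbF. Qed.

(** * The rank profile over a field *)

(** Positivity of the mixed second difference, as a boolean; under the hypotheses of
    [mixed_diff_step] the difference is 0 or 1 and equals this boolean. *)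
Definition mixed_diff (rho : nat -> nat -> nat) (i j : nat) : bool :=
  (rho i j.+1 + rho i.+1 j < rho i.+1 j.+1 + rho i j)%N.

Lemma mixed_diffC (rho : nat -> nat -> nat) (i j : nat) :
  mixed_diff rho i j = mixed_diff (fun k l => rho l k) j i.
Proof. by rewrite /mixed_diff addnC. Qed.

(* The increment [rho i.+1 j - rho i j] is 0 at j = 0, at most 1, and
   nondecreasing in j, so it jumps at most once. *)
Lemma mixed_diff_step {rho : nat -> nat -> nat} :
  (forall i, rho i 0 = 0)%N ->
  (forall i j, rho i.+1 j <= (rho i j).+1)%N ->
  (forall i j i' j', i <= i' -> j <= j' ->
     rho i' j + rho i j' <= rho i' j' + rho i j)%N ->
  (forall i j, rho i.+1 j.+1 + rho i j =
     rho i j.+1 + rho i.+1 j + mixed_diff rho i j)%N /\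
  (forall i j k, mixed_diff rho i j -> mixed_diff rho i k -> (k <= j)%N).
Proof.
move=> rho0 step supermod.
have mono i j k : (j <= k)%N -> (rho i.+1 j + rho i k <= rho i.+1 k + rho i j)%N.
  exact: supermod.
rewrite /mixed_diff; split=> [i j | i j k bij bik].
  have := mono i 0 j (leq0n _); have := mono i j j.+1 (leqnSn _).
  have := step i j.+1; rewrite !rho0.
  by case: ltnP => /=; lia.
(* Jumps at [j] and at a later [k] would make the increment at least 2 at [k.+1], against [step]. *)
rewrite leqNgt; apply/negP => lt_jk.
have := mono i 0 j (leq0n _); have := mono i j.+1 k lt_jk.
have := step i k.+1; rewrite !rho0; move: bij bik; clear.
by lia.
Qed.

(** The witness is a boolean pattern rather than a matrix over [F], so that the same pattern can be
    read over the domain. *)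
Lemma rank_profile_exists {F : fieldType} {m n : nat} (B : 'M[F]_(m, n)) :
  exists b : 'I_m -> 'I_n -> bool,
    let P : 'M[F]_(m, n) := \matrix_(i, j) (b i j)%:R in
    \rank P = nnz P /\
    (forall i j, (i <= m)%N -> (j <= n)%N ->
       \rank (trunc_mx i j P) = \rank (trunc_mx i j B)).
Proof.
pose rho i j := \rank (trunc_mx i j B).
exists (fun i j => mixed_diff rho i j) => P.
have P0 i j : (P i j != 0) = mixed_diff rho i j.
  by rewrite mxE; case: mixed_diff; rewrite ?oner_eq0 ?eqxx.
have supermod : forall i j i' j', (i <= i' -> j <= j' ->
    rho i' j + rho i j' <= rho i' j' + rho i j)%N := trunc_rank_supermod B.
have rho0r i : rho i 0%N = 0%N by rewrite /rho trunc_mx0r mxrank0.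
have rho0l j : rho 0%N j = 0%N by rewrite /rho trunc_mx0l mxrank0.
have [diffE rowP] := mixed_diff_step rho0r (trunc_rankSl B) supermod.
(* Exchanging the two indices gives at most one jump per column. *)
have [|_ colP] := @mixed_diff_step (fun j i => rho i j) rho0l
  (fun j i => trunc_rankSr B i j).
  by move=> j i j' i' le_j le_i; rewrite addnC supermod.
have rkP : \rank P = nnz P.
  apply: partial_perm_mx_rank => [i j | i j k | i j k]; rewrite !P0.
  - by rewrite mxE => ->.
  - by move=> bij bik; apply/val_inj/anti_leq; rewrite !(rowP i).
  - rewrite ![mixed_diff rho _ k]mixed_diffC => bik bjk.
    by apply/val_inj/anti_leq; rewrite !(colP k).
split=> // i j; rewrite nnz_trunc_rank //.
(* Both [nnz (trunc_mx i j P)] and [rho] vanish on the boundary and have mixed second difference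
   [mixed_diff rho i j]. *)
move: i j; apply: mixed_diff_inj => [i | j | i j lt_im lt_jn].
- by rewrite -nnz_trunc_rank // !trunc_mx0r.
- by rewrite -nnz_trunc_rank // !trunc_mx0l.
have := nnz_truncSS P (Ordinal lt_im) (Ordinal lt_jn); rewrite P0 /= => ->.
have := diffE i j; rewrite /rho => ->.
by rewrite [LHS]addnAC [RHS]addnAC; congr (_ + _)%N; apply: addnC.
Qed.

(** Leading ranks are here leading counts of nonzero entries, whose mixed second differences recover
    the support. *)
Lemma rank_profile_uniq {F : fieldType} {m n : nat} {P Q : 'M[F]_(m, n)} :
  \rank P = nnz P -> \rank Q = nnz Q ->
  (forall i j, (i <= m)%N -> (j <= n)%N ->
     \rank (trunc_mx i j P) = \rank (trunc_mx i j Q)) ->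
  forall i j, (P i j != 0) = (Q i j != 0).
Proof.
move=> rkP rkQ rkPQ i j.
have nnzPQ k l : (k <= m)%N -> (l <= n)%N ->
    nnz (trunc_mx k l P) = nnz (trunc_mx k l Q).
  by rewrite -!nnz_trunc_rank //; apply: rkPQ.
have := nnz_truncSS P i j; rewrite !nnzPQ ?(ltnW (ltn_ord _)) // nnz_truncSS.
by move/addnI; case: (P i j != 0); case: (Q i j != 0).
Qed.

(** * Transfer from the fraction field back to the domain *)

Lemma mccoy_rank_leading (D : idomainType) (m n i j : nat) (le_im : (i <= m)%N)
    (le_jn : (j <= n)%N) (A : 'M[D]_(m, n)) :
  mccoy_rank (leading_submx le_im le_jn A) =
  \rank (trunc_mx i j (map_mx (@tofrac D) A)).
Proof. by rewrite mccoy_rank_tofrac map_mxsub mxrank_leading_submx. Qed.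

Lemma nnz_tofrac (D : idomainType) (m n : nat) (A : 'M[D]_(m, n)) :
  nnz (map_mx (@tofrac D) A) = nnz A.
Proof. by apply: eq_card => ij; rewrite !inE mxE tofrac_eq0. Qed.

Theorem corollary8 (D : idomainType) (hD : is_PID D) (m n r : nat)
    (A : 'M[D]_(m, n)) (hA : mccoy_rank A = r) :
  exists! P : 'M[D]_(m, n),
    is_subperm_mx r P /\
    (forall (i j : nat) (le_im : (i <= m)%N) (le_jn : (j <= n)%N),
       (1 <= i)%N -> (1 <= j)%N ->
       mccoy_rank (leading_submx le_im le_jn P)
       = mccoy_rank (leading_submx le_im le_jn A)).
Proof.
have [b [rkP rkPA]] := rank_profile_exists (map_mx (@tofrac D) A).
set P := \matrix_(i, j) _ in rkP rkPA.
(* The pattern [b] read over [D]; [tofrac] preserves 0 and 1, hence maps it to [P]. *)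
pose PD : 'M[D]_(m, n) := \matrix_(i, j) (b i j)%:R.
have PDE : map_mx (@tofrac D) PD = P by apply/matrixP => i j; rewrite !mxE rmorph_nat.
have rk_PD : mccoy_rank PD = r.
  rewrite mccoy_rank_tofrac PDE -hA mccoy_rank_tofrac.
  by rewrite -[P]trunc_mx_id rkPA // trunc_mx_id.
exists PD; split=> [|Q [[rkQ nnzQ Q1] rkQA]].
  split=> [|i j le_im le_jn _ _]; last by rewrite !mccoy_rank_leading PDE rkPA.
  split=> // [|i j]; last by rewrite mxE; case: (b i j); rewrite ?eqxx.
  by rewrite -/(nnz PD) -nnz_tofrac PDE -rkP -PDE -mccoy_rank_tofrac.
have rkQF : \rank (map_mx (@tofrac D) Q) = nnz (map_mx (@tofrac D) Q).
  by rewrite -mccoy_rank_tofrac nnz_tofrac rkQ.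
have rkPQ i j : (i <= m)%N -> (j <= n)%N ->
    \rank (trunc_mx i j P) = \rank (trunc_mx i j (map_mx (@tofrac D) Q)).
  (* The assumption on [Q] covers positive sizes only; at size 0 both truncations are the zero
     matrix. *)
  case: i => [|i] le_im; first by rewrite !trunc_mx0l.
  case: j => [|j] le_jn; first by rewrite !trunc_mx0r.
  by rewrite rkPA // -mccoy_rank_leading rkQA // mccoy_rank_leading.
have eq_supp := rank_profile_uniq rkP rkQF rkPQ.
(* Equal supports suffice, since the nonzero entries of both matrices are 1. *)
apply/matrixP => i j; have := eq_supp i j; rewrite !mxE tofrac_eq0.
case: (b i j); rewrite ?oner_eq0 ?eqxx => /esym; first by move/Q1.
by move/negbFE/eqP.
Qed.
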